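(* With probability $1/2$, the sublinear perceptron returns a solution $\bar{x}$ that is an $\varepsilon$-approximation.
   Context: The sublinear perceptron is the following algorithm. Input: $\varepsilon>0$ and a matrix $A \in \mathbb{R}^{n \times d}$ whose rows $A_i$ all lie in the Euclidean unit ball $\mathbb{B}\subset\mathbb{R}^d$. Set $T \gets 200^2 \varepsilon^{-2}\log n$, $y_1 \gets 0$, $w_1 \gets \mathbf{1}_n$ (the all-ones $n$-vector), $\eta\gets \frac{1}{100} \sqrt{\frac{\log n}{T}}$. For $t=1,\dots,T$: let $p_t \gets w_t/\|w_t\|_1$ and $x_t \gets y_t/\max\{1,\|y_t\|\}$; choose $i_t\in[n]$ with probability $p_t(i)$; set $y_{t+1} \gets y_t + \frac{1}{\sqrt{2T}} A_{i_t}$; choose $j_t\in[d]$ with probability $x_t(j)^2/\|x_t\|^2$; for each $i\in[n]$ set $\tilde v_t(i) \gets A_i(j_t)\|x_t\|^2/x_t(j_t)$, $v_t(i) \gets \mathrm{clip}(\tilde v_t(i), 1/\eta)$ where $\mathrm{clip}(z,V)=\min\{V,\max\{-V,z\}\}$, and $w_{t+1}(i) \gets w_t(i)(1-\eta v_t(i)+\eta^2 v_t(i)^2)$. Return $\bar{x} = \frac{1}{T}\sum_t x_t$. A vector $x_\varepsilon\in\mathbb{B}$ is an $\varepsilon$-approximate solution if for all $i'$, $A_{i'} x_\varepsilon \geq \max_{x\in\mathbb{B}} \min_i A_i x - \varepsilon$. *)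

(* Defs.v *)
From HB Require Import structures.
From mathcomp Require Import all_boot all_order all_algebra.
From mathcomp Require Import all_classical all_reals all_analysis.
Set Implicit Arguments. Unset Strict Implicit. Unset Printing Implicit Defensive.
Import Order.TTheory GRing.Theory Num.Theory.
Local Open Scope ring_scope.

Section Perceptron.
Variables (R : realType) (n d : nat).

Definition dotv (m : nat) (u v : 'rV[R]_m) : R := \sum_(j < m) u 0 j * v 0 j.
Definition normv (m : nat) (u : 'rV[R]_m) : R := Num.sqrt (dotv u u).

Definition clip (z V : R) : R := Num.min V (Num.max (- V) z).

Definition Ax (A : 'M[R]_(n, d)) (i : 'I_n) (x : 'rV[R]_d) : R := dotv (row i A) x.

(* max_{x in B} min_i A_i x  (the max is attained; we write it as a sup) *)
Definition opt_margin (A : 'M[R]_(n, d)) : R :=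
  sup [set inf [set Ax A i x | i in [set: 'I_n]] | x in [set x : 'rV[R]_d | normv x <= 1]].

Definition eps_approx (A : 'M[R]_(n, d)) (eps : R) (xe : 'rV[R]_d) : Prop :=
  normv xe <= 1 /\ forall i' : 'I_n, Ax A i' xe >= opt_margin A - eps.

Definition T_of (eps : R) : nat :=
  `| Num.ceil (200 ^+ 2 * eps ^-2 * ln (n%:R : R)) |%N.
Definition eta_of (eps : R) : R :=
  100^-1 * Num.sqrt (ln (n%:R : R) / (T_of eps)%:R).

(* State (y_t, w_t) of the algorithm; a random choice at step t is (i_t, j_t). *)
Definition state := ('rV[R]_d * 'rV[R]_n)%type.
Definition choice := ('I_n * 'I_d)%type.

Definition x_of (y : 'rV[R]_d) : 'rV[R]_d := (Num.max 1 (normv y))^-1 *: y.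

Definition init_state : state := (0, const_mx 1).

(* v_t(i); convention: when x_t = 0 (e.g. t = 1) the l2-sample is undefined
   and the estimator of A_i x_t = 0 is taken to be 0. *)
Definition v_of (A : 'M[R]_(n, d)) (eps : R) (x : 'rV[R]_d) (j : 'I_d) (i : 'I_n) : R :=
  if x == 0 then 0
  else clip (A i j * normv x ^+ 2 / x 0 j) (eta_of eps)^-1.

Definition step (A : 'M[R]_(n, d)) (eps : R) (st : state) (c : choice) : state :=
  let y := st.1 in let w := st.2 in let x := x_of y in
  (y + (Num.sqrt (2 * (T_of eps)%:R))^-1 *: row c.1 A,
   \row_i (w 0 i * (1 - eta_of eps * v_of A eps x c.2 i
                      + (eta_of eps) ^+ 2 * (v_of A eps x c.2 i) ^+ 2))).

(* Probability of choice c = (i, j) given the current state: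
   p_t(i) * x_t(j)^2 / ||x_t||^2 (i and j drawn independently);
   if x_t = 0, j is drawn uniformly (irrelevant, since then v_t = 0). *)
Definition step_prob (st : state) (c : choice) : R :=
  let y := st.1 in let w := st.2 in let x := x_of y in
  (w 0 c.1 / \sum_(k < n) w 0 k) *
  (if x == 0 then (d%:R)^-1 else x 0 c.2 ^+ 2 / normv x ^+ 2).

Fixpoint states (A : 'M[R]_(n, d)) (eps : R) (st : state) (s : seq choice) : seq state :=
  if s is c :: s' then st :: states A eps (step A eps st c) s' else [::].

Fixpoint path_prob (A : 'M[R]_(n, d)) (eps : R) (st : state) (s : seq choice) : R :=
  if s is c :: s' then step_prob st c * path_prob A eps (step A eps st c) s' else 1.

Definition xbar (A : 'M[R]_(n, d)) (eps : R) (s : seq choice) : 'rV[R]_d :=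
  ((T_of eps)%:R)^-1 *: \sum_(st <- states A eps init_state s) x_of st.1.

Definition success_prob (A : 'M[R]_(n, d)) (eps : R) : R :=
  \sum_(s : (T_of eps).-tuple choice | `[< eps_approx A eps (xbar A eps s) >])
     path_prob A eps init_state s.

End Perceptron.

(* Main.v *)
Require Import Defs.
From HB Require Import structures.
From mathcomp Require Import all_boot all_order all_algebra.
From mathcomp Require Import all_classical all_reals all_analysis.
From mathcomp Require Import ring lra.
Set Implicit Arguments.
Unset Strict Implicit.
Unset Printing Implicit Defensive.
Import Order.TTheory GRing.Theory Num.Theory.
Local Open Scope ring_scope.

(* Put r := sqrt (log n / T), so that eta = r / 100, log n = r^2 T and
   200 r <= eps: a total loss of 200 r T is affordable.  Along every path,
   - online gradient descent (potential: the Huber function of y) costs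
     3/2 r T against a fixed near-optimal x;
   - multiplicative weights gives, for every i,
       sum_t p_t . (v_t - eta v_t^2) <= sum_t v_t(i) + (log n) / eta,
     where (log n) / eta = 100 r T.
   The remaining terms are random.  Clipping biases v_t(i) by at most eta / 4
   and E[v_t(i)^2] <= 1.
   - sum_t (v_t(i) - A_i x_t) has exponential moment e^(77 eta^2 T) at parameter
     4 eta, so by a union bound over i it exceeds 76 r T with probability at
     most n^-2 <= 1/4.
   - sum_t (A_(i_t) x_t - p_t . (v_t - eta v_t^2)), once centered, is a martingale
     with increments of variance at most 10; Chebyshev's inequality shows that
     it exceeds 20 r T with probability at most 1/20, and the conditional means
     add up to at most 5/4 eta T.
   Hence the success probability is at least 7/10. *)

(** * Quadratic bounds on the exponential, and clipping *)

Section RealInequalities.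
Variable R : realType.
Implicit Types u x z V : R.

(** At [u / 8] the bound follows from [e^v <= 1 / (1 - v)]; squaring it three times doubles the
    argument up to [u]. A doubling from coefficient [a] to [b] needs
    [4 b >= 1 + 2 a + 2 a r + a^2 r^2] on its range, which 8/7, 9/10, 21/25, 1 satisfy in turn. *)
Lemma expR_le_quadratic u : -1 <= u <= 1 -> expR u <= 1 + u + u ^+ 2.
Proof.
move=> /andP[u1 u2].
have dbl (a b r : R) : 0 <= b -> 0 <= 1 + r + a * r ^+ 2 ->
    expR r <= 1 + r + a * r ^+ 2 ->
    (1 + r + a * r ^+ 2) ^+ 2 <= 1 + 2 * r + b * (2 * r) ^+ 2 ->
    expR (2 * r) <= 1 + 2 * r + b * (2 * r) ^+ 2.
  move=> b0 p0 h; apply: le_trans.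
  rewrite (_ : 2 * r = r + r); last by ring.
  by rewrite expRD expr2 ler_pM ?expR_ge0.
(* Here [1 / (1 - v) = 1 + v + v^2 / (1 - v)] with [1 - v >= 7/8]. *)
have e8 : expR (u / 8) <= 1 + u / 8 + (8 / 7) * (u / 8) ^+ 2.
  have := expR_ge1Dx (- (u / 8)); rewrite expRN => h.
  have E0 := expR_gt0 (u / 8).
  have h2 : (1 - u / 8) * expR (u / 8) <= 1.
    by rewrite -ler_pdivlMr // div1r.
  have h3 : expR (u / 8) <= (1 - u / 8)^-1.
    by rewrite -[leRHS]mul1r ler_pdivlMr ?(mulrC (expR _)) //; lra.
  apply: le_trans h3 _.
  rewrite -[leLHS]mul1r ler_pdivrMr; last by lra.
  nra.
have e4 : expR (u / 4) <= 1 + u / 4 + (9 / 10) * (u / 4) ^+ 2.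
  rewrite (_ : u / 4 = 2 * (u / 8)); last by field.
  apply: (dbl _ _ _ _ _ e8); [lra|nra|].
  set r := u / 8. have r1 : -1/8 <= r <= 1/8 by rewrite /r; apply/andP; split; lra.
  move/andP: r1 => [ra rb].
  have s0 : 0 <= r ^+ 2 by exact: sqr_ge0.
  have -> : 1 + 2 * r + 9 / 10 * (2 * r) ^+ 2 = (1 + r + 8 / 7 * r ^+ 2) ^+ 2
     + r ^+ 2 * (36 / 10 - 1 - 16 / 7 - 16 / 7 * r - 64 / 49 * r ^+ 2) by field.
  rewrite lerDl; apply: mulr_ge0; [exact: s0|nra].
have e2 : expR (u / 2) <= 1 + u / 2 + (21 / 25) * (u / 2) ^+ 2.
  rewrite (_ : u / 2 = 2 * (u / 4)); last by field.
  apply: (dbl _ _ _ _ _ e4); [lra|nra|].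
  set r := u / 4. have r1 : -1/4 <= r <= 1/4 by rewrite /r; apply/andP; split; lra.
  move/andP: r1 => [ra rb].
  have s0 : 0 <= r ^+ 2 by exact: sqr_ge0.
  have -> : (1 + 2 * r + 21 / 25 * (2 * r) ^+ 2) = (1 + r + 9 / 10 * r ^+ 2) ^+ 2
     + r ^+ 2 * (84 / 25 - 1 - 18 / 10 - 18 / 10 * r - 81 / 100 * r ^+ 2) by field.
  rewrite lerDl; apply: mulr_ge0; [exact: s0|nra].
rewrite (_ : u = 2 * (u / 2)); last by field.
rewrite -[X in _ + X]mul1r.
apply: (dbl _ _ _ _ _ e2); [lra|nra|].
set r := u / 2. have r1 : -1/2 <= r <= 1/2 by rewrite /r; apply/andP; split; lra.
move/andP: r1 => [ra rb].
have s0 : 0 <= r ^+ 2 by exact: sqr_ge0.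
have -> : (1 + 2 * r + 1 * (2 * r) ^+ 2) = (1 + r + 21 / 25 * r ^+ 2) ^+ 2
   + r ^+ 2 * (4 - 1 - 42 / 25 - 42 / 25 * r - 441 / 625 * r ^+ 2) by field.
rewrite lerDl; apply: mulr_ge0; [exact: s0|nra].
Qed.

(** In [(1 + u + u^2)^4] the coefficients from degree 2 on sum to [3^4 - 1 - 4 = 76], and
    [u^k <= u^2] in those degrees. *)
Lemma expR4_le_quadratic u : -1 <= u <= 1 -> expR (4 * u) <= 1 + 4 * u + 76 * u ^+ 2.
Proof.
move=> u1; have := expR_le_quadratic u1; move/andP: u1 => [u1 u2] h.
rewrite (_ : 4 * u = (u + u) + (u + u)); last by ring.
rewrite !expRD.
have p0 : 0 <= 1 + u + u ^+ 2 by nra.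
have hh : expR u * expR u <= (1 + u + u ^+ 2) ^+ 2.
  by rewrite expr2 ler_pM ?expR_ge0.
have : (expR u * expR u) * (expR u * expR u) <= (1 + u + u ^+ 2) ^+ 2 * (1 + u + u ^+ 2) ^+ 2.
  by rewrite ler_pM ?mulr_ge0 ?expR_ge0.
move/le_trans; apply.
have s1 : u ^+ 2 <= 1 by nra.
have s0 : 0 <= u ^+ 2 by exact: sqr_ge0.
have -> : 1 + (u + u + (u + u)) + 76 * u ^+ 2 = (1 + u + u ^+ 2) ^+ 2 * (1 + u + u ^+ 2) ^+ 2
  + u ^+ 2 * (16 * (1 - u) + 19 * (1 - u ^+ 2) + 16 * (1 - u * u ^+ 2)
     + 10 * (1 - u ^+ 2 * u ^+ 2) + 4 * (1 - u * (u ^+ 2 * u ^+ 2))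
     + (1 - u ^+ 2 * u ^+ 2 * u ^+ 2)) by ring.
set a := u ^+ 2 in s0 s1 *.
have aa : 0 <= a * a <= 1 by apply/andP; split; nra.
have aaa : a * a * a <= 1 by move/andP: aa => [? ?]; nra.
move/andP: aa => [aa0 aa1].
rewrite lerDl; apply: mulr_ge0; first exact: s0.
have t1 : u * a <= 1 by nra.
have t2 : u * (a * a) <= 1 by nra.
lra.
Qed.

(** Because [e^(1/2) <= 1 + 1/2 + 1/4 < 2]. *)
Lemma ln2_ge_half : 2^-1 <= ln 2 :> R.
Proof.
rewrite -[2^-1 in leLHS]expRK ler_ln ?posrE ?expR_gt0 //.
apply: le_trans (expR_le_quadratic _) _; [apply/andP; split|]; lra.
Qed.

Lemma clip_norm z V : 0 < V -> - V <= clip z V <= V.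
Proof.
move=> V0; rewrite /clip le_min ge_min le_max lexx /= lexx orTb andbT.
lra.
Qed.

Lemma sqr_clip_le z V : 0 < V -> clip z V ^+ 2 <= z ^+ 2.
Proof.
move=> V0; rewrite /clip /Num.min /Num.max.
case: ifPn => [|/negbTE]; case: ifPn => [|/negbTE] h1 h2; nra.
Qed.

(* [|z| - V <= z^2 / (4 V)] by AM-GM. *)
Lemma clip_bias z V : 0 < V -> `|clip z V - z| <= z ^+ 2 / (4 * V).
Proof.
move=> V0.
have s1 := sqr_ge0 (z - 2 * V); have s2 := sqr_ge0 (z + 2 * V).
have key : - (z ^+ 2) <= (clip z V - z) * (4 * V) <= z ^+ 2.
  rewrite /clip /Num.min /Num.max.
  case: (ltP (- V) z) => h1; case: (ltP V _) => h2; apply/andP; split; nra.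
rewrite ler_norml -mulNr ler_pdivrMr ?ler_pdivlMr //; lra.
Qed.

End RealInequalities.

(** * The unit ball and the Huber potential *)

Section Vectors.
Variables (R : realType) (m : nat).
Implicit Types u v w x y g : 'rV[R]_m.

Lemma dotvC u v : dotv u v = dotv v u.
Proof. by apply: eq_bigr => j _; rewrite mulrC. Qed.

Lemma dotvDr u v w : dotv u (v + w) = dotv u v + dotv u w.
Proof. by rewrite -big_split; apply: eq_bigr => j _; rewrite mxE mulrDr. Qed.

Lemma dotvZr a u v : dotv u (a *: v) = a * dotv u v.
Proof. by rewrite /dotv mulr_sumr; apply: eq_bigr => j _; rewrite mxE mulrCA. Qed.

Lemma dotv0r u : dotv u 0 = 0.
Proof. by rewrite -[X in dotv _ X](scale0r (0 : 'rV[R]_m)) dotvZr mul0r. Qed.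

Lemma dotvDl u v w : dotv (v + w) u = dotv v u + dotv w u.
Proof. by rewrite !(dotvC _ u) dotvDr. Qed.

Lemma dotvZl a u v : dotv (a *: v) u = a * dotv v u.
Proof. by rewrite !(dotvC _ u) dotvZr. Qed.

Lemma dotv_sumr (I : Type) (r : seq I) (F : I -> 'rV[R]_m) u :
  dotv u (\sum_(i <- r) F i) = \sum_(i <- r) dotv u (F i).
Proof.
elim: r => [|a r IH]; first by rewrite !big_nil dotv0r.
by rewrite !big_cons dotvDr IH.
Qed.

Lemma dotv_ge0 u : 0 <= dotv u u.
Proof. by apply: sumr_ge0 => j _; rewrite -expr2 sqr_ge0. Qed.

Lemma normv_ge0 u : 0 <= normv u.
Proof. exact: sqrtr_ge0. Qed.

Lemma sqr_normv u : normv u ^+ 2 = dotv u u.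
Proof. by rewrite sqr_sqrtr ?dotv_ge0. Qed.

Lemma normv_le1 u : (normv u <= 1) = (dotv u u <= 1).
Proof. by rewrite -sqr_normv expr_le1 ?normv_ge0. Qed.

Lemma dotv_eq0 u : (dotv u u == 0) = (u == 0).
Proof.
apply/idP/eqP => [|->]; last by rewrite dotv0r.
rewrite psumr_eq0 => [/allP h|j _]; last by rewrite -expr2 sqr_ge0.
apply/rowP => j; have := h j (mem_index_enum _).
by rewrite /= mulf_eq0 orbb mxE => /eqP.
Qed.

(** Expanding [|u - v|^2 >= 0] suffices. *)
Lemma dotv_le1 u v : dotv u u <= 1 -> dotv v v <= 1 -> dotv u v <= 1.
Proof.
move=> u1 v1; have := dotv_ge0 (u + (-1) *: v).
rewrite dotvDr !dotvDl !dotvZr !dotvZl (dotvC v u); lra.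
Qed.

Lemma dotv_geN1 u v : dotv u u <= 1 -> dotv v v <= 1 -> -1 <= dotv u v.
Proof.
move=> u1 v1; have := dotv_ge0 (u + v).
rewrite dotvDr !dotvDl (dotvC v u); lra.
Qed.

(** The square of the sum expands into [k^2] inner products, each at most 1. *)
Lemma dotv_average_le1 (k : nat) (X : seq 'rV[R]_m) :
  (0 < k)%N -> size X = k -> (forall x, x \in X -> dotv x x <= 1) ->
  dotv (k%:R^-1 *: \sum_(x <- X) x) (k%:R^-1 *: \sum_(x <- X) x) <= 1.
Proof.
move=> k0 sX X1; rewrite dotvZr dotvZl mulrA -invfM.
have kk : 0 < k%:R * k%:R :> R by rewrite mulr_gt0 ?ltr0n.
rewrite mulrC ler_pdivrMr // mul1r dotv_sumr -sX.
have cnt (a : R) (r : seq 'rV[R]_m) : \sum_(x <- r) a = (size r)%:R * a.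
  by rewrite big_const_seq count_predT iter_addr addr0 mulr_natl.
apply: (@le_trans _ _ (\sum_(x <- X) (size X)%:R)); last by rewrite cnt.
rewrite [leLHS]big_seq [leRHS]big_seq; apply: ler_sum => x xX.
rewrite dotvC dotv_sumr -[leRHS]mulr1 -cnt !big_seq.
by apply: ler_sum => z zX; apply: dotv_le1; apply: X1.
Qed.

Lemma x_of_le1 y : dotv (x_of y) (x_of y) <= 1.
Proof.
rewrite /x_of dotvZr dotvZl mulrA -invfM -sqr_normv.
have h1 : 1 <= Num.max 1 (normv y) by rewrite le_max lexx.
have h2 : normv y <= Num.max 1 (normv y) by rewrite le_max lexx orbT.
set K := Num.max _ _ in h1 h2 *; have := normv_ge0 y => n0.
have K0 : 0 < K * K by nra.
by rewrite mulrC ler_pdivrMr // mul1r expr2; apply: ler_pM.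
Qed.

(* The convex conjugate of [|x|^2 / 2] on the unit ball, i.e. the Huber
   function; its gradient is [x_of]. *)
Definition huber y : R :=
  let K := Num.max 1 (normv y) in dotv y y / (2 * K) + (K - 1) / 2.

(** The right-hand side is minimal over [K >= 1] at the [K] used in [huber], so even a [K] chosen
    for another point gives an upper bound. *)
Lemma huber_le y (K : R) : 1 <= K -> huber y <= dotv y y / (2 * K) + (K - 1) / 2.
Proof.
move=> K1; rewrite /huber -sqr_normv; set N := normv y.
have N0 : 0 <= N := normv_ge0 y.
have K0 : 0 < K by lra.
rewrite -subr_ge0 /Num.max; case: ltP => N1.
  rewrite (_ : _ - _ = (K - N) ^+ 2 / (2 * K)); last by field; apply/andP; split; lra.
  by rewrite divr_ge0 ?sqr_ge0 //; lra.
rewrite (_ : _ - _ = (K - 1) * (K - N ^+ 2) / (2 * K)); last by field; lra.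
by rewrite divr_ge0 //; [rewrite mulr_ge0; nra|lra].
Qed.

(** Keeping the [K] of [y] as a suboptimal choice at [y + h g] leaves only the second-order term
    [h^2 |g|^2 / (2 K)]. *)
Lemma huber_step y g (h : R) : dotv g g <= 1 ->
  huber (y + h *: g) <= huber y + h * dotv g (x_of y) + h ^+ 2 / 2.
Proof.
move=> g1; set K := Num.max 1 (normv y).
have K1 : 1 <= K by rewrite le_max lexx.
apply: le_trans (huber_le _ K1) _.
rewrite /huber /x_of -/K dotvZr !dotvDr !dotvDl !dotvZr !dotvZl (dotvC y g).
have g0 := dotv_ge0 g.
rewrite -subr_ge0 (_ : _ - _ = h ^+ 2 / 2 * (1 - dotv g g / K)); last by field; lra.
rewrite mulr_ge0 ?divr_ge0 ?sqr_ge0 // subr_ge0 ler_pdivrMr; lra.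
Qed.

(** Fenchel-Young, obtained by scaling [|y / K - x|^2 >= 0] by [K / 2]; the loss 1/2 is the maximum
    of [|x|^2 / 2] on the ball. *)
Lemma huber_ge x y : dotv x x <= 1 -> dotv x y - 1 / 2 <= huber y.
Proof.
move=> x1; rewrite /huber; set K := Num.max 1 (normv y).
have K1 : 1 <= K by rewrite le_max lexx.
have := dotv_ge0 (K^-1 *: y + (-1) *: x).
rewrite !dotvDr !dotvDl !dotvZr !dotvZl (dotvC y x) => h.
have : 0 <= K / 2 * (K^-1 * (K^-1 * dotv y y) + -1 * (K^-1 * dotv x y)
   + (K^-1 * (-1 * dotv x y) + -1 * (-1 * dotv x x))) by apply: mulr_ge0 => //; lra.
rewrite (_ : K / 2 * _ = dotv y y / (2 * K) - dotv x y + K / 2 * dotv x x); last by field; lra.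
nra.
Qed.

End Vectors.

(** * Moments of a finite distribution *)

Section FiniteMoments.
Variables (R : realType) (C : finType) (P : C -> R).
Hypothesis P_ge0 : forall c, 0 <= P c.
Hypothesis P_sum1 : \sum_c P c = 1.

Lemma mean_const a : \sum_c P c * a = a.
Proof. by rewrite -mulr_suml P_sum1 mul1r. Qed.

Lemma mean_le f g : (forall c, f c <= g c) -> \sum_c P c * f c <= \sum_c P c * g c.
Proof. by move=> fg; apply: ler_sum => c _; rewrite ler_wpM2l. Qed.

Lemma meanD f g :
  \sum_c P c * (f c + g c) = \sum_c P c * f c + \sum_c P c * g c.
Proof. by rewrite -big_split; apply: eq_bigr => c _; rewrite mulrDr. Qed.

Lemma meanZ a f : \sum_c P c * (a * f c) = a * \sum_c P c * f c.
Proof. by rewrite mulr_sumr; apply: eq_bigr => c _; rewrite mulrCA. Qed.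

Lemma variance f (mu := \sum_c P c * f c) :
  \sum_c P c * (f c - mu) ^+ 2 = \sum_c P c * f c ^+ 2 - mu ^+ 2.
Proof.
rewrite (eq_bigr (fun c => P c * (f c ^+ 2 + ((- 2 * mu) * f c + mu ^+ 2)))).
  by rewrite !meanD meanZ mean_const -/mu; ring.
by move=> c _; congr (_ * _); ring.
Qed.

(** Jensen's inequality, from the nonnegativity of the variance. *)
Lemma sqr_mean_le f : (\sum_c P c * f c) ^+ 2 <= \sum_c P c * f c ^+ 2.
Proof.
rewrite -subr_ge0 -variance; apply: sumr_ge0 => c _.
by rewrite mulr_ge0 ?sqr_ge0.
Qed.

End FiniteMoments.

(** * The Markov chain of the algorithm and sums along its paths *)

Section Chain.
Variables (R : realType) (n d : nat) (A : 'M[R]_(n, d)) (eps : R).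
Hypothesis n_gt0 : (0 < n)%N.
Hypothesis d_gt0 : (0 < d)%N.
Implicit Types (st : state R n d) (c : Defs.choice n d) (s : seq (Defs.choice n d)).

(** Invariant of the chain under which [step_prob] is a probability distribution. *)
Definition weights_pos st := forall i, 0 < st.2 0 i.

Definition row_dist st (i : 'I_n) : R := st.2 0 i / \sum_(k < n) st.2 0 k.

Definition col_dist st (j : 'I_d) : R :=
  let x := x_of st.1 in
  if x == 0 then d%:R^-1 else x 0 j ^+ 2 / normv x ^+ 2.

Definition expect_step st (f : Defs.choice n d -> R) : R :=
  \sum_c step_prob st c * f c.

Definition expect_path k st (F : seq (Defs.choice n d) -> R) : R :=
  \sum_(s : k.-tuple (Defs.choice n d)) path_prob A eps st s * F s.

(** [D] sees the state before the choice, so its conditional mean given the past is an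
    [expect_step]. *)
Fixpoint path_sum (D : state R n d -> Defs.choice n d -> R) st s : R :=
  if s is c :: s' then D st c + path_sum D (step A eps st c) s' else 0.

Lemma step_probE st c : step_prob st c = row_dist st c.1 * col_dist st c.2.
Proof. by []. Qed.

Lemma sum_weights_gt0 st : weights_pos st -> 0 < \sum_(k < n) st.2 0 k.
Proof.
move=> wp; rewrite (bigD1 (Ordinal n_gt0)) //=.
by apply: ltr_pwDl => //; apply: sumr_ge0 => k _; exact: ltW.
Qed.

Lemma row_dist_ge0 st i : weights_pos st -> 0 <= row_dist st i.
Proof. by move=> wp; rewrite divr_ge0 ?ltW ?sum_weights_gt0. Qed.

Lemma row_dist_sum1 st : weights_pos st -> \sum_i row_dist st i = 1.
Proof.
by move=> wp; rewrite -mulr_suml divff // gt_eqF // sum_weights_gt0.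
Qed.

Lemma col_dist_ge0 st j : 0 <= col_dist st j.
Proof. by rewrite /col_dist; case: ifP => _; rewrite ?invr_ge0 ?ler0n ?divr_ge0 ?sqr_ge0. Qed.

Lemma col_dist_sum1 st : \sum_j col_dist st j = 1.
Proof.
rewrite /col_dist /=; have [x0|x0] := boolP (x_of st.1 == 0).
  by rewrite sumr_const card_ord -(mulr_natr d%:R^-1) mulVf // pnatr_eq0 -lt0n.
rewrite -mulr_suml sqr_normv (_ : \sum_(i < d) _ = dotv (x_of st.1) (x_of st.1)).
  by rewrite divff // dotv_eq0.
by apply: eq_bigr => j _; rewrite expr2.
Qed.

Lemma step_prob_ge0 st c : weights_pos st -> 0 <= step_prob st c.
Proof. by move=> wp; rewrite step_probE mulr_ge0 ?row_dist_ge0 ?col_dist_ge0. Qed.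

Lemma expect_stepE st f : expect_step st f =
  \sum_i row_dist st i * \sum_j col_dist st j * f (i, j).
Proof.
rewrite /expect_step; under [RHS]eq_bigr => i _ do rewrite mulr_sumr.
by rewrite pair_bigA; apply: eq_bigr => -[i j] _; rewrite step_probE /= mulrA.
Qed.

Lemma step_prob_sum1 st : weights_pos st -> \sum_c step_prob st c = 1.
Proof.
move=> wp; have := expect_stepE st (fun=> 1); rewrite /expect_step.
under eq_bigr => c _ do rewrite mulr1.
move=> ->; rewrite -[RHS](row_dist_sum1 wp); apply: eq_bigr => i _.
by rewrite (mean_const (col_dist_sum1 st)) mulr1.
Qed.

Lemma weights_pos_step st c : weights_pos st -> weights_pos (step A eps st c).
Proof.
move=> wp i; rewrite mxE mulr_gt0 ?wp //.
(* The polynomial [1 - s + s^2] has negative discriminant. *)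
set z := eta_of _ _; nra.
Qed.

Lemma weights_pos_init : weights_pos (init_state R n d).
Proof. by move=> i; rewrite mxE. Qed.

Lemma expect_path0 st F : expect_path 0 st F = F [::].
Proof.
rewrite /expect_path (big_pred1 [tuple]) ?mul1r // => t.
by apply/esym/eqP; exact: tuple0.
Qed.

(** First-step analysis: the rest of the path starts from the updated state, and head and tail give
    the bijection of tuples. The moment bounds along paths are inductions through this identity. *)
Lemma expect_pathS k st F : expect_path k.+1 st F =
  expect_step st (fun c => expect_path k (step A eps st c) (fun s => F (c :: s))).
Proof.
rewrite /expect_path /expect_step.
under [RHS]eq_bigr => c _ do rewrite mulr_sumr.
rewrite pair_bigA.
rewrite (reindex (fun p : Defs.choice n d * k.-tuple (Defs.choice n d) => [tuple of p.1 :: p.2])) /=.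
  by apply: eq_bigr => -[c s] _ /=; rewrite mulrA.
exists (fun t : k.+1.-tuple (Defs.choice n d) => (thead t, [tuple of behead t])) => [[c s] _|t _] /=.
  by congr pair; apply: val_inj.
by rewrite [RHS]tuple_eta.
Qed.

Lemma path_prob_ge0 st s : weights_pos st -> 0 <= path_prob A eps st s.
Proof.
elim: s st => [|c s IH] st wp //=.
by rewrite mulr_ge0 ?step_prob_ge0 ?IH //; exact: weights_pos_step.
Qed.

Lemma expect_path_le k st F G : weights_pos st -> (forall s, size s = k -> F s <= G s) ->
  expect_path k st F <= expect_path k st G.
Proof. by move=> wp FG; apply: ler_sum => s _; rewrite ler_wpM2l ?path_prob_ge0 ?FG ?size_tuple. Qed.

Lemma expect_path_const k st a : weights_pos st -> expect_path k st (fun=> a) = a.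
Proof.
elim: k st => [|k IH] st wp; first by rewrite expect_path0.
rewrite expect_pathS -[RHS](mean_const (step_prob_sum1 wp)).
by apply: eq_bigr => c _; rewrite IH //; exact: weights_pos_step.
Qed.

Lemma expect_pathD k st F G :
  expect_path k st (fun s => F s + G s) = expect_path k st F + expect_path k st G.
Proof. by rewrite -big_split; apply: eq_bigr => c _; rewrite mulrDr. Qed.

Lemma expect_pathZ k st a F :
  expect_path k st (fun s => a * F s) = a * expect_path k st F.
Proof. by rewrite [RHS]mulr_sumr; apply: eq_bigr => c _; rewrite mulrCA. Qed.

Lemma expect_path_sum (I : finType) k st (F : I -> seq (Defs.choice n d) -> R) :
  expect_path k st (fun s => \sum_i F i s) = \sum_i expect_path k st (F i).
Proof. by rewrite [RHS]exchange_big; apply: eq_bigr => s _; rewrite mulr_sumr. Qed.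

(** Conditioning on the first choice factors out its exponential, so the one-step bounds
    multiply. *)
Lemma expect_path_expR (D : state R n d -> Defs.choice n d -> R) (l K : R) k st :
  weights_pos st ->
  (forall st', weights_pos st' ->
     expect_step st' (fun c => expR (l * D st' c)) <= expR K) ->
  expect_path k st (fun s => expR (l * path_sum D st s)) <= expR (k%:R * K).
Proof.
move=> wp hD; elim: k st wp => [|k IH] st wp.
  by rewrite expect_path0 /= mulr0 mul0r.
rewrite expect_pathS.
apply: (@le_trans _ _ (expect_step st (fun c => expR (k%:R * K) * expR (l * D st c)))).
  apply: mean_le => [c|c]; first exact: step_prob_ge0.
  rewrite mulrC; set E := expect_path _ _ _.
  have -> : E = expR (l * D st c) * expect_path k (step A eps st c)
      (fun s => expR (l * path_sum D (step A eps st c) s)).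
    by rewrite -expect_pathZ; apply: eq_bigr => s _; rewrite /= mulrDr expRD.
  rewrite ler_wpM2l ?expR_ge0 //.
  by apply: IH; exact: weights_pos_step.
rewrite /expect_step meanZ mulrS mulrDl mul1r expRD mulrC.
by rewrite ler_wpM2r ?expR_ge0 ?hD.
Qed.

(* The increments are orthogonal because each is centered given the past. *)
Lemma expect_path_sqr (D : state R n d -> Defs.choice n d -> R) (K b : R) k st :
  weights_pos st ->
  (forall st', weights_pos st' -> expect_step st' (D st') = 0) ->
  (forall st', weights_pos st' -> expect_step st' (fun c => D st' c ^+ 2) <= K) ->
  expect_path k st (fun s => (b + path_sum D st s) ^+ 2) <= b ^+ 2 + k%:R * K.
Proof.
(* The offset [b] is generalized because the first increment joins it before the induction
   hypothesis applies. *)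
move=> wp D0 D2; elim: k st b wp => [|k IH] st b wp.
  by rewrite expect_path0 /= addr0 mul0r addr0.
rewrite expect_pathS.
apply: (@le_trans _ _ (expect_step st (fun c =>
    D st c ^+ 2 + (2 * b * D st c + (b ^+ 2 + k%:R * K))))).
  apply: mean_le => [c|c]; first exact: step_prob_ge0.
  under [leLHS]eq_bigr => s _ do rewrite /= addrA.
  apply: le_trans (IH _ _ (weights_pos_step c wp)) _.
  by rewrite le_eqVlt; apply/orP; left; apply/eqP; ring.
rewrite /expect_step !meanD meanZ !(mean_const (step_prob_sum1 wp)).
have := D0 _ wp; have := D2 _ wp; rewrite /expect_step => h2 ->.
rewrite mulr0 add0r -natr1 mulrDl mul1r; lra.
Qed.

End Chain.

(** * Conditional moments of a single step *)

Section OneStep.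
Variables (R : realType) (n d : nat) (A : 'M[R]_(n, d)) (eps : R).
Hypothesis n_gt0 : (0 < n)%N.
Hypothesis d_gt0 : (0 < d)%N.
Hypothesis A_le1 : forall i, dotv (row i A) (row i A) <= 1.
Local Notation eta := (eta_of n eps).
Hypothesis eta_gt0 : 0 < eta.
Implicit Types (st : state R n d) (c : Defs.choice n d).

Definition estimate st j i : R := v_of A eps (x_of st.1) j i.

Definition margin st i : R := Ax A i (x_of st.1).

Lemma sqr_margin_le1 st i : margin st i ^+ 2 <= 1.
Proof.
have := dotv_le1 (A_le1 i) (x_of_le1 st.1).
have := dotv_geN1 (A_le1 i) (x_of_le1 st.1).
rewrite /margin /Ax; nra.
Qed.

(** The clipping level [1 / eta] serves this purpose: [eta v] falls in the range of the quadratic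
    bounds on the exponential. *)
Lemma estimate_bound st j i : -1 <= eta * estimate st j i <= 1.
Proof.
rewrite /estimate /v_of; case: ifP => _; first by rewrite mulr0; lra.
have := clip_norm (A i j * normv (x_of st.1) ^+ 2 / x_of st.1 0 j)
  (V := eta^-1).
rewrite invr_gt0 => /(_ eta_gt0) /andP[h1 h2].
have := ler_wpM2l (ltW eta_gt0) h1; have := ler_wpM2l (ltW eta_gt0) h2.
by rewrite mulrN divff ?lt0r_neq0 // => -> ->.
Qed.

(** The probability [x_j^2 / |x|^2] cancels the denominator, leaving [A_ij^2 |x|^2] per column. *)
Lemma mean_sqr_unclipped st i : x_of st.1 != 0 ->
  \sum_j col_dist st j * (A i j * normv (x_of st.1) ^+ 2 / x_of st.1 0 j) ^+ 2 <= 1.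
Proof.
move=> /negbTE x0; rewrite /col_dist /= x0; set x := x_of st.1 in x0 *.
have N0 : normv x ^+ 2 != 0 by rewrite sqr_normv dotv_eq0 x0.
have N1 : normv x ^+ 2 <= 1 by rewrite sqr_normv; exact: x_of_le1.
apply: le_trans (A_le1 i); apply: ler_sum => j _; rewrite [row i A 0 j]mxE.
(* A coordinate with [x_j = 0] has probability 0, so the division by zero is harmless. *)
have [->|xj] := eqVneq (x 0 j) 0.
  by rewrite expr0n /= !mul0r -expr2 sqr_ge0.
have Nge := sqr_ge0 (normv x).
move: (normv x ^+ 2) N0 N1 Nge => N N0 N1 Nge.
rewrite (_ : _ * _ = A i j * A i j * N); last by field; rewrite N0 xj.
have := sqr_ge0 (A i j); rewrite expr2; nra.
Qed.

(** Importance sampling by squared coordinates is unbiased before clipping. *)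
Lemma mean_unclipped st i : x_of st.1 != 0 ->
  \sum_j col_dist st j * (A i j * normv (x_of st.1) ^+ 2 / x_of st.1 0 j) = margin st i.
Proof.
move=> /negbTE x0; rewrite /col_dist /= x0 /margin; set x := x_of st.1 in x0 *.
have N0 : normv x ^+ 2 != 0 by rewrite sqr_normv dotv_eq0 x0.
apply: eq_bigr => j _; rewrite [row i A 0 j]mxE.
have [->|xj] := eqVneq (x 0 j) 0; first by rewrite expr0n /= !mul0r mulr0.
move: (normv x ^+ 2) N0 => N N0; by field; rewrite N0 xj.
Qed.

(** By [clip_bias] at [V = 1 / eta], clipping costs [eta / 4] times the squared unclipped estimate,
    whose mean is at most 1. At [x_t = 0] there is no bias. *)
Lemma estimate_bias st i :
  `|\sum_j col_dist st j * estimate st j i - margin st i| <= eta / 4.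
Proof.
have [x0|x0] := eqVneq (x_of st.1) 0.
  rewrite big1 => [|j _]; last by rewrite /estimate /v_of x0 eqxx mulr0.
  by rewrite /margin /Ax x0 dotv0r subr0 normr0 divr_ge0 ?ltW.
rewrite -mean_unclipped // -sumrB; apply: le_trans (ler_norm_sum _ _ _) _.
rewrite -[leRHS]mul1r; apply: (@le_trans _ _ (\sum_j col_dist st j *
  (A i j * normv (x_of st.1) ^+ 2 / x_of st.1 0 j) ^+ 2 * (eta / 4))).
  apply: ler_sum => j _; rewrite -mulrBr normrM ger0_norm ?col_dist_ge0 // -[leRHS]mulrA.
  rewrite ler_wpM2l ?col_dist_ge0 // /estimate /v_of (negbTE x0).
  have V0 : 0 < eta^-1 by rewrite invr_gt0.
  apply: le_trans (clip_bias _ V0) _.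
  by rewrite invfM invrK [4^-1 * _]mulrC.
by rewrite -mulr_suml ler_wpM2r ?mean_sqr_unclipped // divr_ge0 ?ltW.
Qed.

Lemma estimate_second_moment st i :
  \sum_j col_dist st j * estimate st j i ^+ 2 <= 1.
Proof.
have [x0|x0] := eqVneq (x_of st.1) 0.
  by rewrite big1 => [|j _]; rewrite ?ler01 // /estimate /v_of x0 eqxx expr0n mulr0.
apply: le_trans (mean_sqr_unclipped i x0); apply: mean_le => [j|j].
  exact: col_dist_ge0.
by rewrite /estimate /v_of (negbTE x0) sqr_clip_le // invr_gt0.
Qed.

Lemma expect_step_col st (f : 'I_d -> R) : weights_pos st ->
  expect_step st (fun c => f c.2) = \sum_j col_dist st j * f j.
Proof.
by move=> wp; rewrite expect_stepE /= (mean_const (row_dist_sum1 n_gt0 wp)).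
Qed.

Lemma expect_step_row st (f : 'I_n -> R) : weights_pos st ->
  expect_step st (fun c => f c.1) = \sum_i row_dist st i * f i.
Proof.
move=> wp; rewrite expect_stepE /=; apply: eq_bigr => i _.
by rewrite (mean_const (col_dist_sum1 d_gt0 st)).
Qed.

Definition overestimate i st c : R := estimate st c.2 i - margin st i.

(** With [a] the margin, [e^(4 eta v)] has mean at most [1 + 4 eta a + 77 eta^2]: 76 comes from the
    second moment, 1 from [4 eta] times the bias [eta / 4]. *)
Lemma expect_expR_overestimate i st : weights_pos st ->
  expect_step st (fun c => expR (4 * eta * overestimate i st c)) <= expR (77 * eta ^+ 2).
Proof.
move=> wp; rewrite (expect_step_col (fun j => expR (4 * eta * (estimate st j i - _)))) //.
set a := margin st i.
apply: (@le_trans _ _ (\sum_j col_dist st j * (expR (- (4 * eta * a)) *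
   (1 + (4 * eta * estimate st j i + 76 * eta ^+ 2 * estimate st j i ^+ 2))))).
  apply: mean_le => [j|j]; first exact: col_dist_ge0.
  rewrite mulrBr addrC expRD ler_wpM2l ?expR_ge0 // -mulrA addrA.
  apply: le_trans (expR4_le_quadratic (estimate_bound st j i)) _.
  by rewrite exprMn !mulrA.
rewrite meanZ !meanD !meanZ (mean_const (col_dist_sum1 d_gt0 st)).
rewrite (_ : 77 * eta ^+ 2 = - (4 * eta * a) + (4 * eta * a + 77 * eta ^+ 2)); last by ring.
rewrite expRD ler_wpM2l ?expR_ge0 //; apply: le_trans (expR_ge1Dx _).
have := estimate_second_moment st i; have := estimate_bias st i.
rewrite ler_norml -/a => /andP[_ h1] h2.
have e2 : 0 <= eta ^+ 2 by exact: sqr_ge0.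
have := ler_wpM2l e2 h2; have := ler_wpM2l (ltW eta_gt0) h1.
set S1 := \sum_j _; set S2 := \sum_j _; lra.
Qed.

(** Chosen so that one step multiplies the total weight by exactly [1 - eta * mw_gain]. *)
Definition mw_gain st j : R :=
  \sum_i row_dist st i * (estimate st j i - eta * estimate st j i ^+ 2).

(** Links the two regret bounds: gradient descent controls the margin of the played row,
    multiplicative weights control [mw_gain]. *)
Definition play_gap st c : R := margin st c.1 - mw_gain st c.2.

Lemma mean_mw_gain st : weights_pos st ->
  \sum_j col_dist st j * mw_gain st j
  = \sum_i row_dist st i * (\sum_j col_dist st j * estimate st j i
      - eta * \sum_j col_dist st j * estimate st j i ^+ 2).
Proof.
move=> wp; rewrite /mw_gain; under eq_bigr => j _ do rewrite mulr_sumr.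
rewrite exchange_big; apply: eq_bigr => i _ /=.
rewrite -mulNr -meanZ -meanD mulr_sumr; apply: eq_bigr => j _.
by rewrite mulNr mulrCA.
Qed.

(** As [i_t] is drawn from [p_t], the mean margin cancels against the mean estimate up to the bias
    [eta / 4]; the quadratic term adds at most [eta]. *)
Lemma expect_play_gap st : weights_pos st ->
  expect_step st (play_gap st) <= 5 / 4 * eta.
Proof.
move=> wp.
have -> : expect_step st (play_gap st) = expect_step st (fun c => margin st c.1)
    + -1 * expect_step st (fun c => mw_gain st c.2).
  rewrite /expect_step -meanZ -meanD; apply: eq_bigr => c _.
  by rewrite mulN1r.
rewrite expect_step_row // (expect_step_col (mw_gain st)) // mean_mw_gain //.
rewrite -meanZ -meanD -[leRHS](mean_const (row_dist_sum1 n_gt0 wp)).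
apply: mean_le => [i|i]; first exact: row_dist_ge0.
have := estimate_second_moment st i; have := estimate_bias st i.
rewrite ler_norml => /andP[h1 _] h2.
have := ler_wpM2l (ltW eta_gt0) h2.
move: h1; set S1 := \sum_j _; set S2 := \sum_j _; lra.
Qed.

(** Use [(a - b)^2 <= 2 a^2 + 2 b^2] with [a^2 <= 1]; by Jensen and [|1 - eta v| <= 2], the mean of
    [b^2] is at most 4. *)
Lemma expect_sqr_play_gap st : weights_pos st ->
  expect_step st (fun c => play_gap st c ^+ 2) <= 10.
Proof.
move=> wp.
have p0 i := row_dist_ge0 n_gt0 i wp.
apply: (@le_trans _ _ (expect_step st (fun c => 2 * margin st c.1 ^+ 2
    + \sum_i row_dist st i * (8 * estimate st c.2 i ^+ 2)))).
  apply: mean_le => [c|c]; first exact: step_prob_ge0.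
  have h : mw_gain st c.2 ^+ 2 <= \sum_i row_dist st i * (4 * estimate st c.2 i ^+ 2).
    apply: le_trans (sqr_mean_le _ (row_dist_sum1 n_gt0 wp) _) _ => //.
    apply: mean_le => // i.
    have /andP[e1 e2] := estimate_bound st c.2 i.
    rewrite (_ : _ - _ = estimate st c.2 i * (1 - eta * estimate st c.2 i)); last by ring.
    rewrite exprMn mulrC ler_wpM2r ?sqr_ge0 //.
    by set t := eta * _ in e1 e2 *; nra.
  rewrite (_ : \sum_i _ = 2 * \sum_i row_dist st i * (4 * estimate st c.2 i ^+ 2)).
    rewrite /play_gap; set a := margin _ _; set b := mw_gain _ _ in h *.
    set S := \sum_i _ in h *.
    have := sqr_ge0 (a + b); nra.
  by rewrite -meanZ; apply: eq_bigr => i _; rewrite [2 * (4 * _)]mulrA -natrM.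
rewrite /expect_step meanD -/(expect_step st (fun c => 2 * margin st c.1 ^+ 2)).
rewrite -/(expect_step st (fun c => \sum_i row_dist st i * (8 * estimate st c.2 i ^+ 2))).
rewrite (expect_step_row (fun i => 2 * margin st i ^+ 2)) //.
rewrite (expect_step_col (fun j => \sum_i row_dist st i * (8 * estimate st j i ^+ 2))) //.
rewrite (_ : 10 = 2 + 8); last by ring.
apply: lerD.
  rewrite -[leRHS](mean_const (row_dist_sum1 n_gt0 wp)); apply: mean_le => // i.
  have := sqr_margin_le1 st i; lra.
under eq_bigr => j _ do rewrite mulr_sumr.
rewrite exchange_big -[leRHS](mean_const (row_dist_sum1 n_gt0 wp)).
apply: ler_sum => i _ /=.
under eq_bigr => j _ do rewrite mulrCA (mulrCA _ 8).
rewrite -mulr_sumr ler_wpM2l // -mulr_sumr.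
have := estimate_second_moment st i; lra.
Qed.

Definition centered_gap st c : R := play_gap st c - expect_step st (play_gap st).

Lemma expect_centered_gap st : weights_pos st -> expect_step st (centered_gap st) = 0.
Proof.
move=> wp; rewrite /expect_step meanD (mean_const (step_prob_sum1 n_gt0 d_gt0 wp)).
by rewrite subrr.
Qed.

Lemma expect_sqr_centered_gap st : weights_pos st ->
  expect_step st (fun c => centered_gap st c ^+ 2) <= 10.
Proof.
move=> wp; apply: le_trans (expect_sqr_play_gap wp).
rewrite /expect_step (variance (step_prob_sum1 n_gt0 d_gt0 wp)).
by rewrite lerBlDr lerDl sqr_ge0.
Qed.

End OneStep.

(** * Regret bounds valid on every path *)

Section Pathwise.
Variables (R : realType) (n d : nat) (A : 'M[R]_(n, d)) (eps : R).
Hypothesis n_gt0 : (0 < n)%N.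
Hypothesis d_gt0 : (0 < d)%N.
Hypothesis A_le1 : forall i, dotv (row i A) (row i A) <= 1.
Local Notation eta := (eta_of n eps).
Local Notation T := (T_of n eps).
Hypothesis eta_gt0 : 0 < eta.
Implicit Types (st : state R n d) (s : seq (Defs.choice n d)).

Lemma path_sumD (D E : state R n d -> Defs.choice n d -> R) st s :
  path_sum A eps (fun st c => D st c + E st c) st s
  = path_sum A eps D st s + path_sum A eps E st s.
Proof. by elim: s st => [|c s IH] st /=; rewrite ?addr0 // IH addrACA. Qed.

Lemma path_sum_states (f : state R n d -> R) st s :
  path_sum A eps (fun st _ => f st) st s = \sum_(st' <- states A eps st s) f st'.
Proof. by elim: s st => [|c s IH] st /=; rewrite ?big_nil // big_cons IH. Qed.

Lemma size_states st s : size (states A eps st s) = size s.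
Proof. by elim: s st => [|c s IH] st //=; rewrite IH. Qed.

Lemma path_sum_margin s i : (0 < T)%N ->
  path_sum A eps (fun st _ => margin A st i) (init_state R n d) s
  = T%:R * Ax A i (xbar A eps s).
Proof.
move=> T0; rewrite path_sum_states /Ax /xbar dotvZr dotv_sumr mulrA divff ?mul1r //.
by rewrite pnatr_eq0 -lt0n.
Qed.

Lemma xbar_le1 s : (0 < T)%N -> size s = T -> dotv (xbar A eps s) (xbar A eps s) <= 1.
Proof.
move=> T0 sT; rewrite /xbar -(big_map (fun st => x_of st.1) predT id).
apply: dotv_average_le1 => //; first by rewrite size_map size_states.
by move=> _ /mapP[st _ ->]; exact: x_of_le1.
Qed.

(** A single weight is at most the total. Its update factor is at least [e^(- eta v)], while the
    total is multiplied by [1 - eta g <= e^(- eta g)], where [g] is the gain. *)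
Lemma multiplicative_weights st s i : weights_pos st ->
  st.2 0 i * expR (- eta * path_sum A eps (fun st c => estimate A eps st c.2 i) st s)
  <= (\sum_k st.2 0 k) * expR (- eta * path_sum A eps (fun st c => mw_gain A eps st c.2) st s).
Proof.
elim: s st => [|c s IH] st wp /=.
  rewrite mulr0 expR0 !mulr1 (bigD1 i) //= lerDl.
  by apply: sumr_ge0 => k _; exact: ltW.
rewrite !mulrDr !expRD !mulrA.
apply: (@le_trans _ _ ((step A eps st c).2 0 i * expR (- eta *
    path_sum A eps (fun st c => estimate A eps st c.2 i) (step A eps st c) s))).
  rewrite ler_wpM2r ?expR_ge0 // mxE ler_wpM2l ?(ltW (wp i)) //.
  rewrite -/(estimate A eps st c.2 i).
  have /andP[e1 e2] := estimate_bound A eta_gt0 st c.2 i.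
  apply: le_trans (expR_le_quadratic _) _; first by rewrite mulNr; apply/andP; split; lra.
  by rewrite mulNr sqrrN exprMn.
apply: le_trans (IH _ (weights_pos_step A eps c wp)) _.
rewrite ler_wpM2r ?expR_ge0 //.
have W0 := sum_weights_gt0 n_gt0 wp.
rewrite (_ : \sum_k _ = (\sum_k st.2 0 k) * (1 + - eta * mw_gain A eps st c.2)).
  by rewrite ler_wpM2l ?expR_ge1Dx // ltW.
rewrite /mw_gain mulrDr mulr1 mulrCA mulr_sumr.
under [X in _ = _ + _ * X]eq_bigr => k _ do rewrite mulrA.
rewrite mulr_sumr -big_split /=; apply: eq_bigr => k _.
rewrite mxE -/(estimate A eps st c.2 k) /row_dist.
by field; rewrite gt_eqF.
Qed.

Local Notation h := (Num.sqrt (2 * T%:R))^-1.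

(** The potential telescopes by [huber_step]; the base case compares it with [x] through
    [huber_ge]. *)
Lemma online_gradient_descent (x : 'rV[R]_d) st s : dotv x x <= 1 ->
  dotv x st.1 + h * path_sum A eps (fun _ c => Ax A c.1 x) st s - 1 / 2
  <= huber st.1 + h * path_sum A eps (fun st c => margin A st c.1) st s
     + (size s)%:R * (h ^+ 2 / 2).
Proof.
move=> x1; elim: s st => [|c s IH] st /=.
  by rewrite !mulr0 mul0r !addr0; exact: huber_ge.
have := IH (step A eps st c); rewrite /=.
have := huber_step st.1 h (A_le1 c.1).
rewrite (dotvDr x) (dotvZr _ x) /margin /Ax (dotvC x (row _ _)) -natr1 mulrDl !mulrDr mul1r; lra.
Qed.

Lemma path_sum_play_gap st s : weights_pos st ->
  path_sum A eps (play_gap A eps) st s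
  <= path_sum A eps (centered_gap A eps) st s + (size s)%:R * (5 / 4 * eta).
Proof.
elim: s st => [|c s IH] st wp /=; first by rewrite mul0r addr0.
have := expect_play_gap n_gt0 d_gt0 A_le1 eta_gt0 wp.
have := IH _ (weights_pos_step A eps c wp).
rewrite /centered_gap -natr1 mulrDl mul1r; lra.
Qed.

End Pathwise.

(** * Near-optimal comparators *)

Section OptMargin.
Variables (R : realType) (n d : nat) (A : 'M[R]_(n, d)).
Hypothesis n_gt0 : (0 < n)%N.
Hypothesis A_le1 : forall i, dotv (row i A) (row i A) <= 1.

(** The slack [delta] replaces compactness. All inner products lie in [[-1, 1]], so the infima and
    the supremum are over nonempty bounded sets. *)
Lemma near_optimal (delta : R) : 0 < delta -> exists2 x : 'rV[R]_d,
  dotv x x <= 1 & forall i, opt_margin A - delta <= Ax A i x.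
Proof.
move=> delta0; rewrite /opt_margin.
set S := (X in sup X).
have lb (x : 'rV[R]_d) : normv x <= 1 -> has_lbound [set Ax A i x | i in [set: 'I_n]]%classic.
  rewrite normv_le1 => x1; exists (-1) => _ [i _ <-]; exact: dotv_geN1.
have supS : has_sup S.
  split.
    exists (inf [set Ax A i 0 | i in [set: 'I_n]]%classic); exists 0 => //=.
    by rewrite normv_le1 dotv0r.
  exists 1 => _ [x /= x1 <-].
  apply: (@le_trans _ _ (Ax A (Ordinal n_gt0) x)).
    by apply: ge_inf; [exact: lb|exists (Ordinal n_gt0)].
  by apply: dotv_le1 => //; rewrite -normv_le1.
have [_ [x /= x1 <-] hx] := sup_adherent delta0 supS.
exists x; first by rewrite -normv_le1.
move=> i; apply: le_trans (ltW hx) _.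
by apply: ge_inf; [exact: lb|exists i].
Qed.

End OptMargin.

(** * The horizon T and the unit of loss r *)

Section Horizon.
Variables (R : realType) (n : nat) (eps : R).
Hypothesis n_gt1 : (1 < n)%N.
Hypothesis eps_gt0 : 0 < eps.
Local Notation T := (T_of n eps).

Definition rate : R := Num.sqrt (ln n%:R / T%:R).

Lemma ln_n_ge_half : 2^-1 <= ln n%:R :> R.
Proof.
apply: le_trans (ln2_ge_half R) _.
by rewrite ler_ln ?posrE ?ltr0n ?ler_nat // ltnW.
Qed.

Lemma T_of_ge : 200 ^+ 2 * eps ^-2 * ln n%:R <= T%:R.
Proof.
apply: le_trans (ceil_ge _) _.
by rewrite /T_of natr_absz ler_int ler_norm.
Qed.

Lemma T_of_gt0 : 0 < T%:R :> R.
Proof.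
apply: lt_le_trans T_of_ge.
rewrite mulr_gt0 //; last by have := ln_n_ge_half; lra.
by rewrite mulr_gt0 ?exprn_gt0 ?invr_gt0 ?exprn_gt0.
Qed.

Lemma rate_gt0 : 0 < rate.
Proof.
rewrite sqrtr_gt0 divr_gt0 ?T_of_gt0 //; have := ln_n_ge_half; lra.
Qed.

Lemma ln_n_rate : ln n%:R = rate ^+ 2 * T%:R.
Proof.
have L := ln_n_ge_half; have T0 := T_of_gt0.
rewrite sqr_sqrtr ?divfK ?gt_eqF // divr_ge0 ?ltW //; lra.
Qed.

(** Cancel [T] in [200^2 eps^-2 r^2 T <= T]. *)
Lemma rate_le : 200 * rate <= eps.
Proof.
have T0 := T_of_gt0; have r0 := rate_gt0; have L := ln_n_ge_half.
have := T_of_ge; rewrite ln_n_rate mulrA -[leRHS]mul1r ler_pM2r //.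
rewrite mulrAC -exprMn ler_pdivrMr ?exprn_gt0 // mul1r.
by rewrite ler_sqr ?nnegrE ?(ltW eps_gt0) // mulr_ge0 // ltW.
Qed.

Lemma eta_rate : eta_of n eps = 100^-1 * rate.
Proof. by []. Qed.

Lemma eta_of_gt0 : 0 < eta_of n eps.
Proof. by rewrite eta_rate mulr_gt0 ?rate_gt0. Qed.

(** Because [(2 r T)^2 = 4 T ln n >= 2 T], by [ln n >= 1/2]. This converts the descent regret to
    units of [r T]. *)
Lemma sqrt_horizon_le : Num.sqrt (2 * T%:R) <= 2 * (rate * T%:R).
Proof.
have T0 := T_of_gt0; have r0 := rate_gt0; have L := ln_n_ge_half.
have q0 : 0 <= 2 * (rate * T%:R) by rewrite !mulr_ge0 // ltW.
rewrite -(ger0_norm q0) -sqrtr_sqr.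
apply: ler_wsqrtr; rewrite ln_n_rate in L.
by set t := T%:R in T0 L *; nra.
Qed.

End Horizon.

(** * Loss budget, tail bounds and success probability *)

Section Success.
Variables (R : realType) (n d : nat) (A : 'M[R]_(n, d)) (eps : R).
Hypothesis n_gt1 : (1 < n)%N.
Hypothesis d_gt0 : (0 < d)%N.
Hypothesis eps_gt0 : 0 < eps.
Hypothesis A_le1 : forall i, dotv (row i A) (row i A) <= 1.
Local Notation T := (T_of n eps).
Local Notation r := (rate n eps).
Local Notation init := (init_state R n d).

Let n_gt0 : (0 < n)%N := ltnW n_gt1.
Let eta_gt0 := eta_of_gt0 n_gt1 eps_gt0.
Let T_gt0 := T_of_gt0 n_gt1 eps_gt0.

Lemma path_sum_ge (D : state R n d -> Defs.choice n d -> R) a st s :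
  (forall st' c, a <= D st' c) -> (size s)%:R * a <= path_sum A eps D st s.
Proof.
move=> aD; elim: s st => [|c s IH] st /=; first by rewrite mul0r.
by rewrite -add1n natrD mulrDl mul1r lerD.
Qed.

Lemma regret_against x s : dotv x x <= 1 -> size s = T ->
  path_sum A eps (fun _ c => Ax A c.1 x) init s
  <= path_sum A eps (fun st c => margin A st c.1) init s + 3 / 2 * (r * T%:R).
Proof.
move=> x1 sT; have := online_gradient_descent eps A_le1 init s x1.
rewrite /= dotv0r sT.
have -> : huber (0 : 'rV[R]_d) = 0.
  rewrite /huber dotv0r mul0r add0r /normv dotv0r sqrtr0 max_l ?ler01 //.
  by rewrite subrr mul0r.
have rT := sqrt_horizon_le n_gt1 eps_gt0.
have h0 : 0 < Num.sqrt (2 * T%:R) :> R by rewrite sqrtr_gt0 mulr_gt0.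
have h2 : Num.sqrt (2 * T%:R) ^+ 2 = 2 * T%:R :> R.
  by rewrite sqr_sqrtr // ltW // mulr_gt0.
set S1 := path_sum _ _ _ _ _; set S2 := path_sum _ _ _ _ _.
move: (Num.sqrt _) rT h0 h2 => h rT h0 h2.
(* The second-order terms add up to 1/4; with the 1/2 of [huber_ge], rescaling gives
   [3/4 sqrt (2 T) <= 3/2 r T]. *)
rewrite exprVn h2 (_ : T%:R * _ = 4^-1); last by field; rewrite gt_eqF.
rewrite !add0r => hh.
have := ler_wpM2l (ltW h0) hh.
rewrite mulrBr mulrDr !mulrA divff ?gt_eqF // !mul1r; lra.
Qed.

(** Logarithm of the weight inequality from unit weights, with [(ln n) / eta = r^2 T * 100 / r]. *)
Lemma gain_le_estimates s i :
  path_sum A eps (fun st c => mw_gain A eps st c.2) init s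
  <= path_sum A eps (fun st c => estimate A eps st c.2 i) init s + 100 * (r * T%:R).
Proof.
have := multiplicative_weights A n_gt0 eta_gt0 s i (@weights_pos_init R n d).
rewrite /= mxE mul1r.
rewrite (_ : \sum_k _ = expR (ln n%:R)); last first.
  rewrite lnK ?posrE ?ltr0n // (eq_bigr (fun=> 1)) => [|k _]; last by rewrite mxE.
  by rewrite sumr_const card_ord.
rewrite -expRD ler_expR (ln_n_rate n_gt1 eps_gt0) eta_rate.
have r0 := rate_gt0 n_gt1 eps_gt0.
set S1 := path_sum _ _ _ _ _; set S2 := path_sum _ _ _ _ _.
move: r r0 => q q0 h.
rewrite -(ler_pM2l q0); move: h; set t := T%:R; lra.
Qed.

(** In units of [r T] the losses are 1 (comparator), 3/2 (descent), 20 + 1/80 (played rows), 100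
    (weights) and 76 (estimates), in all less than 200. *)
Lemma eps_approx_of_deviations s : size s = T ->
  (forall i, path_sum A eps (overestimate A eps i) init s < 76 * (r * T%:R)) ->
  path_sum A eps (centered_gap A eps) init s < 20 * (r * T%:R) ->
  eps_approx A eps (xbar A eps s).
Proof.
move=> sT hO hC; have T0 : (0 < T)%N by rewrite -(ltr0n R).
split; first by rewrite normv_le1 xbar_le1.
move=> i; have r0 := rate_gt0 n_gt1 eps_gt0.
have [x x1 hx] := near_optimal n_gt0 A_le1 r0.
have e1 := path_sum_ge init s (fun _ c => hx c.1).
have e2 := regret_against x1 sT.
have e3 := path_sum_play_gap n_gt0 d_gt0 A_le1 eta_gt0 s (@weights_pos_init R n d).
have e4 := gain_le_estimates s i.
have e5 := hO i.
have e6 := path_sum_margin A s i T0.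
have e7 : path_sum A eps (fun st c => margin A st c.1) init s =
    path_sum A eps (play_gap A eps) init s
    + path_sum A eps (fun st c => mw_gain A eps st c.2) init s.
  by rewrite -path_sumD; congr path_sum; apply/funext => st; apply/funext => c;
     rewrite subrK.
have e8 : path_sum A eps (fun st c => estimate A eps st c.2 i) init s =
    path_sum A eps (overestimate A eps i) init s
    + path_sum A eps (fun st _ => margin A st i) init s.
  by rewrite -path_sumD; congr path_sum; apply/funext => st; apply/funext => c;
     rewrite subrK.
have e9 := ler_wpM2l (ltW T_gt0) (rate_le n_gt1 eps_gt0).
rewrite sT eta_rate in e1 e3.
rewrite -(ler_pM2l T_gt0) -e6 mulrBr.
rewrite mulrBr [_ * r]mulrC in e1.
rewrite mulrCA [_ * r]mulrC in e9.
rewrite (_ : T%:R * (5 / 4 * (100^-1 * r)) = 80^-1 * (r * T%:R)) in e3; last by field.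
have rT : 0 < r * T%:R by exact: mulr_gt0.
move: (path_sum A eps (play_gap _ _) _ _) (path_sum A eps (centered_gap _ _) _ _)
  (path_sum A eps (fun st c => mw_gain A eps st c.2) init s)
  (path_sum A eps (fun _ c => Ax A c.1 x) init s) (path_sum A eps (overestimate A eps i) init s)
  e1 e2 e3 e4 e5 e7 e8 e9 hC rT => P1 P2 P3 P4 P5.
move: (r * T%:R) => q; lra.
Qed.

(** Chernoff summed over the rows: the exponent is at most
    [(1 - 3.04 + 0.0077) ln n <= - 2 ln 2]. *)
Lemma overestimate_tail :
  expect_path A eps T init (fun s => \sum_i
    expR (4 * eta_of n eps * path_sum A eps (overestimate A eps i) init s
          - 4 * eta_of n eps * (76 * (r * T%:R)))) <= 4^-1.
Proof.
rewrite expect_path_sum; set eta := eta_of n eps; set b := 4 * eta * (76 * (r * T%:R)).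
apply: (@le_trans _ _ (\sum_(i < n) expR (- b + T%:R * (77 * eta ^+ 2)))).
  apply: ler_sum => i _.
  rewrite (_ : expect_path _ _ _ _ _ = expR (- b) * expect_path A eps T init (fun s =>
      expR (4 * eta * path_sum A eps (overestimate A eps i) init s))).
    rewrite expRD ler_wpM2l ?expR_ge0 //.
    apply: expect_path_expR => //; first exact: weights_pos_init.
    by move=> st wp; exact: expect_expR_overestimate.
  by rewrite -expect_pathZ; apply: eq_bigr => s _; rewrite -expRD [- b + _]addrC.
rewrite sumr_const card_ord -(mulr_natl (expR _)).
have nK : n%:R = expR (ln n%:R) :> R by rewrite lnK // posrE ltr0n.
have -> : 4^-1 = expR (- (2 * ln 2)) :> R.
  rewrite expRN (_ : 2 * ln 2 = ln 2 + ln 2); last by ring.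
  by rewrite expRD lnK ?posrE // -natrM.
rewrite [in leLHS]nK -expRD ler_expR.
have l2 : ln 2 <= ln n%:R :> R by rewrite ler_ln ?posrE ?ltr0n ?ler_nat.
have L := ln_n_ge_half R n_gt1.
have E1 : b = 304 / 100 * ln n%:R.
  by rewrite /b /eta eta_rate (ln_n_rate n_gt1 eps_gt0); field.
have E2 : T%:R * (77 * eta ^+ 2) = 77 / 100 / 100 * ln n%:R.
  by rewrite /eta eta_rate (ln_n_rate n_gt1 eps_gt0); field.
rewrite E1 E2; lra.
Qed.

(** Chebyshev: the second moment is at most [10 T], the squared threshold is
    [400 T ln n >= 200 T]. *)
Lemma centered_gap_tail :
  expect_path A eps T init (fun s =>
    path_sum A eps (centered_gap A eps) init s ^+ 2 / (20 * (r * T%:R)) ^+ 2) <= 20^-1.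
Proof.
have r0 := rate_gt0 n_gt1 eps_gt0.
have rT : 0 < r * T%:R by exact: mulr_gt0.
have K0 : 0 < (20 * (r * T%:R)) ^+ 2 by rewrite exprn_gt0 // mulr_gt0.
rewrite (_ : expect_path _ _ _ _ _ = ((20 * (r * T%:R)) ^+ 2)^-1 *
    expect_path A eps T init (fun s => (0 + path_sum A eps (centered_gap A eps) init s) ^+ 2)).
  rewrite mulrC ler_pdivrMr //.
  apply: le_trans (expect_path_sqr A eps n_gt0 d_gt0 (K := 10) 0 T (@weights_pos_init R n d) _ _) _.
  - by move=> st wp; exact: expect_centered_gap.
  - by move=> st wp; exact: expect_sqr_centered_gap.
  rewrite expr0n /= add0r.
  have := ln_n_ge_half R n_gt1; rewrite (ln_n_rate n_gt1 eps_gt0) => L.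
  rewrite (_ : 20^-1 * _ = T%:R * (20 * (r ^+ 2 * T%:R))); last by field.
  by rewrite ler_pM2l //; lra.
by rewrite -expect_pathZ; apply: eq_bigr => s _; rewrite add0r [_ / _]mulrC.
Qed.

(** Markov's inequality: [G] is nonnegative and at least 1 on failing paths, so the success
    indicator dominates [1 - G], of mean at least [1 - 1/4 - 1/20]. *)
Lemma success_prob_ge : 7 / 10 <= success_prob A eps.
Proof.
pose G s := \sum_i
    expR (4 * eta_of n eps * path_sum A eps (overestimate A eps i) init s
          - 4 * eta_of n eps * (76 * (r * T%:R)))
  + path_sum A eps (centered_gap A eps) init s ^+ 2 / (20 * (r * T%:R)) ^+ 2.
have wp := @weights_pos_init R n d.
have r0 := rate_gt0 n_gt1 eps_gt0.
have rT : 0 < r * T%:R by exact: mulr_gt0.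
have K0 : 0 < 20 * (r * T%:R) by exact: mulr_gt0.
have G0 s : 0 <= G s.
  rewrite addr_ge0 ?divr_ge0 ?sqr_ge0 //.
  by apply: sumr_ge0 => i _; exact: expR_ge0.
have Gfail s : size s = T -> ~ eps_approx A eps (xbar A eps s) -> 1 <= G s.
  move=> sT fail; rewrite leNgt; apply/negP => G1; apply: fail.
  (* One excessive deviation already makes its own term of [G] at least 1. *)
  apply: eps_approx_of_deviations => // [i|].
    rewrite ltNge; apply/negP => dev; move: G1; apply/negP; rewrite -leNgt.
    rewrite /G (bigD1 i) //= -addrA -[leLHS]addr0 lerD //.
      rewrite -[leLHS]expR0 ler_expR subr_ge0 ler_wpM2l //.
      by rewrite mulr_ge0 // ltW.
    rewrite addr_ge0 ?divr_ge0 ?sqr_ge0 //.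
    by apply: sumr_ge0 => k _; exact: expR_ge0.
  rewrite ltNge; apply/negP => dev; move: G1; apply/negP; rewrite -leNgt.
  rewrite /G -[leLHS]add0r lerD //.
    by apply: sumr_ge0 => k _; exact: expR_ge0.
  by rewrite ler_pdivlMr ?exprn_gt0 // mul1r ler_sqr ?nnegrE // ?ltW // (lt_le_trans K0).
apply: (@le_trans _ _ (expect_path A eps T init (fun s => 1 + -1 * G s))).
  rewrite expect_pathD expect_path_const // expect_pathZ /G expect_pathD.
  have := overestimate_tail; have := centered_gap_tail. lra.
apply: (@le_trans _ _ (expect_path A eps T init (fun s =>
    (`[< eps_approx A eps (xbar A eps s) >])%:R))).
  apply: expect_path_le => // s sT.
  case: asboolP => [_|fail]; last by have := Gfail s sT fail; rewrite /= mulr0n; lra.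
  by have := G0 s; rewrite /= mulr1n; lra.
rewrite /expect_path /success_prob [leRHS]big_mkcond /=.
apply: ler_sum => s _; case: ifP => _; by rewrite ?mulr1 ?mulr0.
Qed.

End Success.

Theorem mainTheorem2 (R : realType) (n d : nat) (A : 'M[R]_(n, d)) (eps : R) :
  (1 < n)%N -> (0 < d)%N -> 0 < eps ->
  (forall i : 'I_n, normv (row i A) <= 1) ->
  1 / 2 <= success_prob A eps.
Proof.
move=> n1 d0 e0 hA.
have A1 i : dotv (row i A) (row i A) <= 1 by rewrite -normv_le1.
apply: le_trans (success_prob_ge n1 d0 e0 A1); lra.
Qed.
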